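(* There is a harmonic function $h(z)$ on $\mathbb D$ such that $h(z)/\bigl|\log(1-|z|)\bigr|$ is bounded on $\mathbb D$ (for $z\ne0$) but has no radial limits at any point of $\partial\mathbb D$; that is, for no $\xi\in\partial\mathbb D$ does $\lim_{r\to1^-}h(r\xi)/|\log(1-r)|$ exist.
   Context: $\mathbb D$ is the open unit disk in $\mathbb C$ and $\partial\mathbb D$ the unit circle. Harmonic functions are complex-valued; harmonicity for the Euclidean Laplacian and for the hyperbolic Laplacian $\frac{(1-|z|^2)^2}{4}(\partial_x^2+\partial_y^2)$ coincide. *)

(* Defs.v *)
From Stdlib Require Import Reals.
From Coquelicot Require Import Coquelicot.
Open Scope R_scope.

Definition unit_disk (z : C) : Prop := Cmod z < 1.

Definition unit_circle (z : C) : Prop := Cmod z = 1.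

Definition laplacian (u : R -> R -> R) (x y : R) : R :=
  partial_derive 2 0 u x y + partial_derive 0 2 u x y.

(* [ex_diff_n u 2 x y] at every point of an open set [U] says exactly that [u]
   is of class C^2 on [U]: all partial derivatives of order at most 2, mixed
   ones included, exist and are continuous.  Hence Coquelicot's total
   derivatives in [laplacian] are genuine derivatives. *)
Definition harmonicR (U : C -> Prop) (u : C -> R) : Prop :=
  forall x y : R, U (x, y) ->
    ex_diff_n (fun s t => u (s, t)) 2 x y /\
    laplacian (fun s t => u (s, t)) x y = 0.

(* Complex-valued harmonic functions; [U] is meant to be open. *)
Definition harmonic (U : C -> Prop) (h : C -> C) : Prop :=
  harmonicR U (fun z => Re (h z)) /\ harmonicR U (fun z => Im (h z)).

(* h(z) / |log(1 - |z|)|; junk at z = 0, where the denominator vanishes, and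
   outside the open unit disk. *)
Definition log_quotient (h : C -> C) (z : C) : C :=
  (h z / RtoC (Rabs (ln (1 - Cmod z))))%C.

(* Main.v *)
(* The witness is the holomorphic series h(z) = sum_i z^(2^(level i)), where
   [level] is the constant 2x on the block x/64 <= i < x, for x = 64^(k+1).
   - Since i <= level i, |h(z)| is at most a constant times sum_i r^(2^i) with
     r = |z|, and ln (1 + s) >= s/2 together with
     - ln (1 - r) = sum_i ln (1 + r^(2^i)) bounds this by O(- ln (1 - r)).
   - On the circle 1 - r = 2^(-x) only the terms i < x/64 contribute, up to O(1),
     so |h| / |ln (1 - r)| is small there.
   - On the circle 1 - r = 2^(-2x) the whole block contributes (63/64) x z^(2^(2x)),
     with |z^(2^(2x))| >= 1/4, so |h| / |ln (1 - r)| is larger there, whatever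
     the argument of z: only moduli matter, and all radii are treated alike. *)
Require Import Defs.
From Stdlib Require Import Reals Lra Lia.
From Coquelicot Require Import Coquelicot.
Open Scope R_scope.

(** * Modulus inequalities and the binomial remainder *)

Lemma Cmod_le_Rabs (z : C) : Cmod z <= Rabs (Re z) + Rabs (Im z).
Proof.
  destruct z as [x y]; unfold Cmod; simpl.
  apply Rsqr_incr_0_var; [|pose proof (Rabs_pos x); pose proof (Rabs_pos y); lra].
  rewrite Rsqr_sqrt by nra. unfold Rsqr.
  pose proof (Rabs_pos x); pose proof (Rabs_pos y).
  assert (Rabs x * Rabs x = x * x) by (rewrite <- Rabs_mult; apply Rabs_pos_eq; nra).
  assert (Rabs y * Rabs y = y * y) by (rewrite <- Rabs_mult; apply Rabs_pos_eq; nra).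
  nra.
Qed.

Lemma Rabs_Im_le_Cmod (z : C) : Rabs (Im z) <= Cmod z.
Proof. eapply Rle_trans; [apply Rmax_r | apply Rmax_Cmod]. Qed.

(* The binomial remainder, a sum of terms of degree at least 2 in [w], grows at
   least quadratically when [Cmod w] is scaled up to [d]. *)
Lemma Cpow_taylor_bound (z w : C) (d : R) (n : nat) :
  0 <= d -> Cmod w <= d ->
  Cmod ((z + w) ^ n - z ^ n - RtoC (INR n) * w * z ^ pred n)%C * d ^ 2
  <= Cmod w ^ 2 *
     ((Cmod z + d) ^ n - Cmod z ^ n - INR n * d * Cmod z ^ pred n).
Proof.
  intros Hd Hw.
  pose proof (Cmod_ge_0 z) as Hz. pose proof (Cmod_ge_0 w) as Hw0.
  induction n as [|n IH].
  { replace ((z + w) ^ 0 - z ^ 0 - RtoC (INR 0) * w * z ^ pred 0)%C with (RtoC 0)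
      by (simpl; ring).
    rewrite Cmod_0. simpl. lra. }
  set (X := (Cmod z + d) ^ n - Cmod z ^ n - INR n * d * Cmod z ^ pred n) in *.
  set (E := ((z + w) ^ n - z ^ n - RtoC (INR n) * w * z ^ pred n)%C) in *.
  (* The real and the complex remainder obey the same recurrence: multiply by the base, then add [n]
     times the squared increment times a power of degree [n - 1]. The induction compares the two
     term by term. *)
  assert (HX : (Cmod z + d) ^ S n - Cmod z ^ S n - INR (S n) * d * Cmod z ^ pred (S n)
               = (Cmod z + d) * X + INR n * d ^ 2 * Cmod z ^ pred n).
  { unfold X. destruct n; rewrite S_INR; simpl; ring. }
  assert (HE : ((z + w) ^ S n - z ^ S n - RtoC (INR (S n)) * w * z ^ pred (S n)
               = (z + w) * E + RtoC (INR n) * w ^ 2 * z ^ pred n)%C).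
  { unfold E. rewrite S_INR, RtoC_plus. destruct n; simpl; ring. }
  rewrite HX, HE.
  assert (Hp : 0 <= INR n * Cmod z ^ pred n)
    by (apply Rmult_le_pos; [apply pos_INR | now apply pow_le]).
  assert (Hn : Cmod ((z + w) * E + RtoC (INR n) * w ^ 2 * z ^ pred n)%C
     <= (Cmod z + d) * Cmod E + Cmod w ^ 2 * (INR n * Cmod z ^ pred n)).
  { eapply Rle_trans; [apply Cmod_triangle|].
    rewrite !Cmod_mult, Cmod_R, !Cmod_pow, (Rabs_pos_eq (INR n)) by apply pos_INR.
    apply Rplus_le_compat; [|lra].
    apply Rmult_le_compat_r; [apply Cmod_ge_0|].
    eapply Rle_trans; [apply Cmod_triangle|]. lra. }
  apply Rle_trans with
    (((Cmod z + d) * Cmod E + Cmod w ^ 2 * (INR n * Cmod z ^ pred n)) * d ^ 2).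
  - apply Rmult_le_compat_r; [apply pow2_ge_0 | exact Hn].
  - pose proof (Rmult_le_compat_l (Cmod z + d) _ _ ltac:(lra) IH). lra.
Qed.

(** The left side is the term of degree one in [d] of the binomial expansion. Hence a slightly
    larger radius absorbs the factor [n] produced by differentiation. *)
Lemma pow_deriv_bound (s d : R) (n : nat) :
  0 <= s -> 0 <= d -> INR n * d * s ^ pred n <= (s + d) ^ n.
Proof.
  intros Hs Hd. induction n as [|n IH]; [simpl; lra|].
  rewrite S_INR. simpl pred.
  assert (INR n * d * s ^ n <= s * (s + d) ^ n).
  { destruct n; [simpl in *; lra|]. simpl pred in IH.
    replace (INR (S n) * d * s ^ S n) with (s * (INR (S n) * d * s ^ n)) by (simpl; ring).
    now apply Rmult_le_compat_l. }
  assert (s ^ n <= (s + d) ^ n) by (apply pow_incr; lra).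
  simpl. nra.
Qed.

(** * Absolutely convergent complex series *)

Definition Csummable (u : nat -> C) : Prop := ex_series (fun k => Cmod (u k)).

(** Componentwise, so that real series theory applies; meaningful only when both components
    converge, which [Csummable] guarantees. *)
Definition Cseries (u : nat -> C) : C :=
  (Series (fun k => Re (u k)), Series (fun k => Im (u k))).

Lemma Csummable_le (u : nat -> C) (b : nat -> R) :
  (forall k, Cmod (u k) <= b k) -> ex_series b -> Csummable u.
Proof.
  intros H Hb. unfold Csummable.
  apply (@ex_series_le R_AbsRing R_CompleteNormedModule _ b); [|exact Hb].
  intro k. change (Rabs (Cmod (u k)) <= b k).
  rewrite Rabs_pos_eq by apply Cmod_ge_0. apply H.
Qed.

Lemma ex_series_Re (u : nat -> C) : Csummable u -> ex_series (fun k => Re (u k)).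
Proof.
  apply (@ex_series_le R_AbsRing R_CompleteNormedModule).
  intro k. apply re_le_Cmod.
Qed.

Lemma ex_series_Im (u : nat -> C) : Csummable u -> ex_series (fun k => Im (u k)).
Proof.
  apply (@ex_series_le R_AbsRing R_CompleteNormedModule).
  intro k. apply Rabs_Im_le_Cmod.
Qed.

(** Real and imaginary parts are bounded separately, whence the factor 2; the later constants leave
    room for this loss. *)
Lemma Cmod_Cseries_le (u : nat -> C) (b : nat -> R) :
  (forall k, Cmod (u k) <= b k) -> ex_series b -> Cmod (Cseries u) <= 2 * Series b.
Proof.
  intros H Hb.
  assert (Haux : forall v : nat -> R, (forall k, Rabs (v k) <= b k) ->
                  Rabs (Series v) <= Series b).
  { intros v Hv.
    assert (ex_series (fun k => Rabs (v k))).
    { apply (@ex_series_le R_AbsRing R_CompleteNormedModule _ b); [|exact Hb].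
      intro k. change (Rabs (Rabs (v k)) <= b k). now rewrite Rabs_Rabsolu. }
    eapply Rle_trans; [now apply Series_Rabs|].
    apply Series_le; [|exact Hb]. intro k. split; [apply Rabs_pos | apply Hv]. }
  eapply Rle_trans; [apply Cmod_le_Rabs|]. simpl.
  assert (Rabs (Series (fun k => Re (u k))) <= Series b)
    by (apply Haux; intro k; eapply Rle_trans; [apply re_le_Cmod | apply H]).
  assert (Rabs (Series (fun k => Im (u k))) <= Series b)
    by (apply Haux; intro k; eapply Rle_trans; [apply Rabs_Im_le_Cmod | apply H]).
  lra.
Qed.

Lemma Cseries_minus (u v : nat -> C) :
  Csummable u -> Csummable v ->
  Cseries (fun k => u k - v k)%C = (Cseries u - Cseries v)%C.
Proof.
  intros Hu Hv. unfold Cseries, Cminus, Cplus, Copp. simpl.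
  f_equal.
  - rewrite <- Series_opp, <- Series_plus; [reflexivity | now apply ex_series_Re|].
    apply (ex_series_opp (fun k => Re (v k))). now apply ex_series_Re.
  - rewrite <- Series_opp, <- Series_plus; [reflexivity | now apply ex_series_Im|].
    apply (ex_series_opp (fun k => Im (v k))). now apply ex_series_Im.
Qed.

Lemma Csummable_scal (c : C) (u : nat -> C) :
  Csummable u -> Csummable (fun k => c * u k)%C.
Proof.
  intros Hu. apply Csummable_le with (fun k => Cmod c * Cmod (u k)).
  - intro k. rewrite Cmod_mult. lra.
  - now apply (ex_series_scal (V := R_NormedModule) (Cmod c)).
Qed.

Lemma Cseries_scal (c : C) (u : nat -> C) :
  Csummable u -> Cseries (fun k => c * u k)%C = (c * Cseries u)%C.
Proof.
  intros Hu.
  pose proof (ex_series_Re u Hu) as HR. pose proof (ex_series_Im u Hu) as HI.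
  unfold Cseries, Cmult. simpl.
  f_equal.
  - rewrite <- !Series_scal_l, <- Series_minus; [reflexivity| |];
      now apply (ex_series_scal (V := R_NormedModule)).
  - rewrite <- !Series_scal_l, <- Series_plus; [reflexivity| |];
      now apply (ex_series_scal (V := R_NormedModule)).
Qed.

(** * Power series with prescribed exponents and their complex derivatives *)

Definition gseries (c : nat -> R) (p : nat -> nat) (z : C) : C :=
  Cseries (fun k => RtoC (c k) * z ^ p k)%C.

Definition dcoef (c : nat -> R) (p : nat -> nat) (k : nat) : R := c k * INR (p k).

(* [pred] truncates only where [p k = 0], and there [dcoef c p k = 0]. *)
Definition dexp (p : nat -> nat) (k : nat) : nat := pred (p k).

Definition disk_summable (c : nat -> R) (p : nat -> nat) : Prop :=
  forall r : R, 0 <= r < 1 -> ex_series (fun k => Rabs (c k) * r ^ p k).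

Lemma disk_summable_deriv (c : nat -> R) (p : nat -> nat) :
  disk_summable c p ->
  disk_summable (dcoef c p) (dexp p).
Proof.
  (* The radius [r + d] is the midpoint of [r] and 1, so the hypothesis still applies there. *)
  intros H r Hr. set (d := (1 - r) / 2). assert (Hd : 0 < d) by (unfold d; lra).
  apply (@ex_series_le R_AbsRing R_CompleteNormedModule _
           (fun k => / d * (Rabs (c k) * (r + d) ^ p k))).
  - intro k.
    change (Rabs (Rabs (c k * INR (p k)) * r ^ pred (p k))
            <= / d * (Rabs (c k) * (r + d) ^ p k)).
    rewrite Rabs_mult, Rabs_Rabsolu, Rabs_mult.
    rewrite (Rabs_pos_eq (INR (p k))) by apply pos_INR.
    rewrite (Rabs_pos_eq (r ^ _)) by (apply pow_le; lra).
    apply Rmult_le_reg_l with d; [exact Hd|].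
    replace (d * (/ d * (Rabs (c k) * (r + d) ^ p k)))
      with (Rabs (c k) * (r + d) ^ p k) by (field; lra).
    replace (d * (Rabs (c k) * INR (p k) * r ^ pred (p k)))
      with (Rabs (c k) * (INR (p k) * d * r ^ pred (p k))) by ring.
    apply Rmult_le_compat_l; [apply Rabs_pos|].
    apply pow_deriv_bound; lra.
  - apply (ex_series_scal (V := R_NormedModule) (/ d)). apply H. unfold d. lra.
Qed.

Lemma disk_summable_Csummable (c : nat -> R) (p : nat -> nat) (z : C) :
  disk_summable c p -> Cmod z < 1 -> Csummable (fun k => RtoC (c k) * z ^ p k)%C.
Proof.
  intros H Hz. apply Csummable_le with (fun k => Rabs (c k) * Cmod z ^ p k).
  - intro k. rewrite Cmod_mult, Cmod_R, Cmod_pow. lra.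
  - apply H. split; [apply Cmod_ge_0 | exact Hz].
Qed.

(** Complex differentiability at [z] with derivative [l], multiplied out so that [w = 0] needs no
    exclusion. *)
Definition Cdiff (f : C -> C) (z l : C) : Prop :=
  forall eps : posreal, exists delta : posreal, forall w : C, Cmod w < delta ->
    Cmod (f (z + w) - f z - l * w)%C <= eps * Cmod w.

(** By [Cpow_taylor_bound], the remainder of each term is at most [Cmod w ^ 2 / d ^ 2] times the
    corresponding term of the convergent majorant at radius [Cmod z + d]. Summing makes the whole
    remainder quadratic in [w]. *)
Lemma gseries_Cdiff (c : nat -> R) (p : nat -> nat) (z : C) :
  disk_summable c p -> Cmod z < 1 ->
  Cdiff (gseries c p) z
    (gseries (dcoef c p) (dexp p) z).
Proof.
  intros H Hz eps.
  pose proof (Cmod_ge_0 z) as Hz0.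
  set (d := (1 - Cmod z) / 2). assert (Hd : 0 < d) by (unfold d; lra).
  set (b := fun k => Rabs (c k) * (Cmod z + d) ^ p k).
  assert (Hb : ex_series b) by (apply H; unfold d; lra).
  set (S := Rabs (Series b)).
  assert (HS : 0 <= S) by apply Rabs_pos.
  assert (HSb : Series b <= S) by apply RRle_abs.
  (* [K] bounds the quadratic constant, including the factor 2 of [Cmod_Cseries_le]; the summand 1
     keeps it positive, so that [eps / K] makes sense. *)
  set (K := 2 * S / d ^ 2 + 1).
  assert (Hd2 : 0 < d ^ 2) by now apply pow_lt.
  assert (HK0 : 0 <= 2 * S / d ^ 2)
    by (apply Rmult_le_pos; [lra | left; now apply Rinv_0_lt_compat]).
  assert (HK : 0 < K) by (unfold K; lra).
  assert (Hdel : 0 < Rmin d (eps / K))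
    by (apply Rmin_pos; [lra | apply Rdiv_lt_0_compat; [apply cond_pos | lra]]).
  exists (mkposreal _ Hdel). intros w Hw. simpl in Hw.
  pose proof (Cmod_ge_0 w) as Hw0.
  assert (Hwd : Cmod w < d) by (eapply Rlt_le_trans; [exact Hw | apply Rmin_l]).
  assert (Hwe : Cmod w < eps / K) by (eapply Rlt_le_trans; [exact Hw | apply Rmin_r]).
  assert (Hzw : Cmod (z + w)%C < 1)
    by (eapply Rle_lt_trans; [apply Cmod_triangle|]; unfold d in Hwd; lra).
  pose proof (disk_summable_Csummable _ _ _ H Hz) as S1.
  pose proof (disk_summable_Csummable _ _ _ H Hzw) as S2.
  pose proof (disk_summable_Csummable _ _ _ (disk_summable_deriv _ _ H) Hz) as S3.
  rewrite (Cmult_comm _ w).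
  unfold gseries.
  rewrite <- (Cseries_scal w) by exact S3.
  rewrite <- Cseries_minus by assumption.
  rewrite <- Cseries_minus.
  2:{ apply Csummable_le with
       (fun k => Cmod (RtoC (c k) * (z + w) ^ p k)%C + Cmod (RtoC (c k) * z ^ p k)%C).
      - intro k. unfold Cminus. eapply Rle_trans; [apply Cmod_triangle|].
        rewrite Cmod_opp. lra.
      - now apply (ex_series_plus (V := R_NormedModule)). }
  2: now apply Csummable_scal.
  eapply Rle_trans.
  { apply Cmod_Cseries_le with (b := fun k => Cmod w ^ 2 / d ^ 2 * b k).
    - intro k. unfold b.
      unfold dcoef, dexp.
      replace (RtoC (c k) * (z + w) ^ p k - RtoC (c k) * z ^ p k -
               w * (RtoC (c k * INR (p k)) * z ^ pred (p k)))%C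
        with (RtoC (c k) *
              ((z + w) ^ p k - z ^ p k - RtoC (INR (p k)) * w * z ^ pred (p k)))%C
        by (rewrite RtoC_mult; ring).
      rewrite Cmod_mult, Cmod_R.
      replace (Cmod w ^ 2 / d ^ 2 * (Rabs (c k) * (Cmod z + d) ^ p k))
        with (Rabs (c k) * (Cmod w ^ 2 * (Cmod z + d) ^ p k / d ^ 2)) by (field; lra).
      apply Rmult_le_compat_l; [apply Rabs_pos|].
      apply Rmult_le_reg_r with (d ^ 2); [exact Hd2|].
      eapply Rle_trans; [apply Cpow_taylor_bound; lra|].
      replace (Cmod w ^ 2 * (Cmod z + d) ^ p k / d ^ 2 * d ^ 2)
        with (Cmod w ^ 2 * (Cmod z + d) ^ p k) by (field; lra).
      apply Rmult_le_compat_l; [apply pow2_ge_0|].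
      assert (0 <= Cmod z ^ p k) by now apply pow_le.
      assert (0 <= INR (p k) * d * Cmod z ^ pred (p k)).
      { apply Rmult_le_pos; [apply Rmult_le_pos; [apply pos_INR | lra]|].
        now apply pow_le. }
      lra.
    - now apply (ex_series_scal (V := R_NormedModule)). }
  rewrite Series_scal_l.
  assert (HKe : K * Cmod w <= eps).
  { apply Rmult_lt_compat_l with (r := K) in Hwe; [|exact HK].
    replace (K * (eps / K)) with (pos eps) in Hwe by (field; lra). lra. }
  apply Rle_trans with (K * Cmod w * Cmod w).
  - replace (2 * (Cmod w ^ 2 / d ^ 2 * Series b))
      with (Cmod w ^ 2 * (2 * Series b / d ^ 2)) by (field; lra).
    replace (K * Cmod w * Cmod w) with (Cmod w ^ 2 * K) by ring.
    apply Rmult_le_compat_l; [apply pow2_ge_0|].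
    unfold K.
    assert (2 * Series b / d ^ 2 <= 2 * S / d ^ 2); [|lra].
    apply Rmult_le_compat_r; [left; now apply Rinv_0_lt_compat | lra].
  - now apply Rmult_le_compat_r.
Qed.

(** * From complex differentiability to harmonicity *)

Lemma Cmod_pair_near (x y u v d : R) :
  Rabs (u - x) < d -> Rabs (v - y) < d ->
  Cmod ((u, v) - (x, y))%C < 2 * d.
Proof.
  intros Hu Hv. eapply Rle_lt_trans; [apply Cmod_le_Rabs|]. simpl.
  unfold Rminus in *. lra.
Qed.

Lemma unit_disk_near (x y : R) :
  Cmod (x, y) < 1 -> locally_2d (fun u v => Cmod (u, v) < 1) x y.
Proof.
  (* Half the distance to the circle, because two coordinates each within [d] give a distance below
     [2 * d]. *)
  intros H. set (d := (1 - Cmod (x, y)) / 2).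
  assert (Hd : 0 < d) by (unfold d; lra).
  exists (mkposreal _ Hd). simpl. intros u v Hu Hv.
  pose proof (Cmod_pair_near _ _ _ _ _ Hu Hv) as Hw.
  replace ((u, v) : C) with ((x, y) + ((u, v) - (x, y)))%C by ring.
  eapply Rle_lt_trans; [apply Cmod_triangle|]. unfold d in Hw. lra.
Qed.

(** The complex derivative is restricted to the line through [z] in the unit direction [v]; [v = 1]
    and [v = Ci] give the two partial derivatives. *)
Lemma Cdiff_is_derive (f : C -> C) (z l a v : C) (phi : R -> R) (x : R) :
  Cdiff f z l ->
  Cmod v = 1 ->
  (forall h : R, phi (x + h) = Re (a * f (z + RtoC h * v))%C) ->
  is_derive phi x (Re (a * v * l)%C).
Proof.
  intros Hf Hv Hphi. apply is_derive_Reals. intros eps Heps.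
  pose proof (Cmod_ge_0 a) as Ha.
  (* The added 1 covers [a = 0], and halving [eps] yields the strict inequality at the end. *)
  assert (He : 0 < eps / 2 / (Cmod a + 1)).
  { apply Rdiv_lt_0_compat; lra. }
  destruct (Hf (mkposreal _ He)) as [delta Hdelta]. simpl in Hdelta.
  exists delta. intros h Hh0 Hh.
  assert (Hm : Cmod (RtoC h * v)%C = Rabs h) by (rewrite Cmod_mult, Cmod_R, Hv; ring).
  specialize (Hdelta (RtoC h * v)%C). rewrite Hm in Hdelta. specialize (Hdelta Hh).
  assert (Hx : phi x = Re (a * f z)%C).
  { rewrite <- (Rplus_0_r x), Hphi. do 3 f_equal. ring. }
  rewrite Hphi, Hx.
  assert (Habs : 0 < Rabs h) by now apply Rabs_pos_lt.
  apply Rmult_lt_reg_r with (Rabs h); [exact Habs|].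
  rewrite <- Rabs_mult.
  replace (((Re (a * f (z + RtoC h * v))%C - Re (a * f z)%C) / h - Re (a * v * l)%C) * h)
    with (Re (a * (f (z + RtoC h * v) - f z - l * (RtoC h * v)))%C).
  2:{ destruct (f (z + RtoC h * v)%C), (f z), a, v, l. simpl. field. exact Hh0. }
  eapply Rle_lt_trans; [apply re_le_Cmod|].
  rewrite Cmod_mult.
  apply Rle_lt_trans with (Cmod a * (eps / 2 / (Cmod a + 1) * Rabs h)).
  { now apply Rmult_le_compat_l. }
  rewrite <- Rmult_assoc. apply Rmult_lt_compat_r; [exact Habs|].
  replace (Cmod a * (eps / 2 / (Cmod a + 1)))
    with (eps / 2 * (Cmod a / (Cmod a + 1))) by (field; lra).
  assert (Cmod a / (Cmod a + 1) <= 1).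
  { apply Rmult_le_reg_r with (Cmod a + 1); [lra|].
    unfold Rdiv. rewrite Rmult_assoc, Rinv_l; lra. }
  nra.
Qed.

Lemma Cdiff_derive_x (f : C -> C) (x y : R) (l a : C) :
  Cdiff f (x, y) l ->
  is_derive (fun s => Re (a * f (s, y))%C) x (Re (a * l)%C).
Proof.
  intros Hf. rewrite <- (Cmult_1_r a).
  apply (Cdiff_is_derive f (x, y)); [exact Hf | apply Cmod_1|].
  intro h. rewrite (Cmult_1_r a). do 3 f_equal.
  apply injective_projections; simpl; ring.
Qed.

Lemma Cdiff_derive_y (f : C -> C) (x y : R) (l a : C) :
  Cdiff f (x, y) l ->
  is_derive (fun t => Re (a * f (x, t))%C) y (Re (a * Ci * l)%C).
Proof.
  intros Hf.
  apply (Cdiff_is_derive f (x, y)); [exact Hf | |].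
  - unfold Cmod, Ci. simpl fst; simpl snd. replace (0 ^ 2 + 1 ^ 2) with 1 by ring.
    apply sqrt_1.
  - intro h. do 3 f_equal. apply injective_projections; simpl; ring.
Qed.

Lemma Cdiff_continuity_2d (f : C -> C) (x y : R) (l a : C) :
  Cdiff f (x, y) l -> continuity_2d_pt (fun s t => Re (a * f (s, t))%C) x y.
Proof.
  (* Tolerance 1 suffices: near the point, the increment of [f] is at most [Cmod l + 1] times that
     of its argument. *)
  intros Hf eps. destruct (Hf (mkposreal 1 Rlt_0_1)) as [delta Hdelta].
  simpl in Hdelta.
  set (K := Cmod a * (Cmod l + 1) + 1).
  pose proof (Cmod_ge_0 a). pose proof (Cmod_ge_0 l).
  assert (HK : 1 <= K) by (unfold K; nra).
  assert (Hd : 0 < Rmin (delta / 2) (eps / (2 * K))).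
  { apply Rmin_pos; apply Rdiv_lt_0_compat; try apply cond_pos; lra. }
  exists (mkposreal _ Hd). intros u v Hu Hv. simpl in Hu, Hv.
  pose proof (Cmod_pair_near _ _ _ _ _ Hu Hv) as Hw.
  set (w := ((u, v) - (x, y))%C) in *.
  replace ((u, v) : C) with ((x, y) + w)%C by (unfold w; ring).
  pose proof (Rmin_l (delta / 2) (eps / (2 * K))).
  pose proof (Rmin_r (delta / 2) (eps / (2 * K))).
  specialize (Hdelta w ltac:(lra)).
  assert (Hwe : Cmod w < eps / K).
  { replace (eps / K) with (2 * (eps / (2 * K))) by (field; lra). lra. }
  assert (Heq : Re (a * f ((x, y) + w))%C - Re (a * f (x, y))%C
    = Re (a * ((f ((x, y) + w) - f (x, y) - l * w) + l * w))%C).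
  { clearbody w. destruct (f ((x, y) + w)%C), (f (x, y)), a, l, w. simpl. ring. }
  rewrite Heq.
  eapply Rle_lt_trans; [apply re_le_Cmod|].
  rewrite Cmod_mult.
  assert (Hs : Cmod (f ((x, y) + w) - f (x, y) - l * w + l * w)%C
               <= (Cmod l + 1) * Cmod w).
  { eapply Rle_trans; [apply Cmod_triangle|]. rewrite (Cmod_mult l). lra. }
  pose proof (Cmod_ge_0 w).
  apply Rle_lt_trans with (K * Cmod w).
  - unfold K. apply Rmult_le_compat_l with (r := Cmod a) in Hs; nra.
  - apply Rmult_lt_compat_l with (r := K) in Hwe; [|lra].
    replace (K * (eps / K)) with (pos eps) in Hwe by (field; lra). lra.
Qed.

(* The functions [Re (a * gseries c p)] with a complex factor [a] are closed under
   both partial derivatives, and contain the real and the imaginary parts. *)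
Lemma is_derive_x_gseries (c : nat -> R) (p : nat -> nat) (a : C) (x y : R) :
  disk_summable c p -> Cmod (x, y) < 1 ->
  is_derive (fun s => Re (a * gseries c p (s, y))%C) x
    (Re (a * gseries (dcoef c p) (dexp p) (x, y))%C).
Proof. intros H Hz. exact (Cdiff_derive_x _ _ _ _ a (gseries_Cdiff _ _ _ H Hz)). Qed.

Lemma is_derive_y_gseries (c : nat -> R) (p : nat -> nat) (a : C) (x y : R) :
  disk_summable c p -> Cmod (x, y) < 1 ->
  is_derive (fun t => Re (a * gseries c p (x, t))%C) y
    (Re (a * Ci * gseries (dcoef c p) (dexp p) (x, y))%C).
Proof. intros H Hz. exact (Cdiff_derive_y _ _ _ _ a (gseries_Cdiff _ _ _ H Hz)). Qed.

(** Induction on the order with [c], [p] and [a] general: a partial derivative is again of this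
    form, for the derived series and the factor [a] or [a * Ci]. This identification must hold on a
    neighbourhood, since it is differentiated further. *)
Lemma ex_diff_n_gseries (n : nat) (c : nat -> R) (p : nat -> nat) (a : C) (x y : R) :
  disk_summable c p -> Cmod (x, y) < 1 ->
  ex_diff_n (fun s t => Re (a * gseries c p (s, t))%C) n x y.
Proof.
  revert c p a x y. induction n as [|n IH]; intros c p a x y H Hz.
  - split; [|exact I]. exact (Cdiff_continuity_2d _ _ _ _ a (gseries_Cdiff _ _ _ H Hz)).
  - pose proof (disk_summable_deriv _ _ H) as H'.
    destruct (unit_disk_near x y Hz) as [d Hd].
    split; [exact (Cdiff_continuity_2d _ _ _ _ a (gseries_Cdiff _ _ _ H Hz))|].
    split; [eexists; exact (is_derive_x_gseries _ _ a _ _ H Hz)|].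
    split; [eexists; exact (is_derive_y_gseries _ _ a _ _ H Hz)|].
    split.
    + eapply ex_diff_n_ext_loc; [|exact (IH _ _ a x y H' Hz)].
      exists d. intros u v Hu Hv. symmetry.
      exact (is_derive_unique _ _ _ (is_derive_x_gseries _ _ a _ _ H (Hd u v Hu Hv))).
    + eapply ex_diff_n_ext_loc; [|exact (IH _ _ (a * Ci)%C x y H' Hz)].
      exists d. intros u v Hu Hv. symmetry.
      exact (is_derive_unique _ _ _ (is_derive_y_gseries _ _ a _ _ H (Hd u v Hu Hv))).
Qed.

(** Both pure second derivatives involve the same second complex derivative [l]. Differentiating
    twice in [y] contributes [Ci * Ci = -1], so they cancel. *)
Lemma harmonicR_Re_gseries (c : nat -> R) (p : nat -> nat) (a : C) :
  disk_summable c p -> harmonicR unit_disk (fun z => Re (a * gseries c p z)%C).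
Proof.
  intros H x y Hz. unfold unit_disk in Hz.
  split; [now apply ex_diff_n_gseries|].
  pose proof (disk_summable_deriv _ _ H) as H'.
  destruct (unit_disk_near x y Hz) as [d Hd].
  assert (Hc : forall u : R, Rabs (u - u) < d)
    by (intro u; rewrite Rminus_diag, Rabs_R0; apply cond_pos).
  set (l := gseries (dcoef (dcoef c p) (dexp p)) (dexp (dexp p)) (x, y)).
  assert (Hxx : partial_derive 2 0 (fun s t => Re (a * gseries c p (s, t))%C) x y
                = Re (a * l)%C).
  { eapply eq_trans; [|exact (is_derive_unique _ _ _ (is_derive_x_gseries _ _ a _ _ H' Hz))].
    apply Derive_ext_loc. exists d. intros u Hu.
    exact (is_derive_unique _ _ _ (is_derive_x_gseries _ _ a _ _ H (Hd u y Hu (Hc y)))). }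
  assert (Hyy : partial_derive 0 2 (fun s t => Re (a * gseries c p (s, t))%C) x y
                = Re (a * Ci * Ci * l)%C).
  { eapply eq_trans; [|exact (is_derive_unique _ _ _ (is_derive_y_gseries _ _ (a * Ci)%C _ _ H' Hz))].
    apply Derive_ext_loc. exists d. intros u Hu.
    exact (is_derive_unique _ _ _ (is_derive_y_gseries _ _ a _ _ H (Hd x u (Hc x) Hu))). }
  unfold laplacian. rewrite Hxx, Hyy. clearbody l. destruct a, l. simpl. ring.
Qed.

Lemma harmonic_gseries (c : nat -> R) (p : nat -> nat) :
  disk_summable c p -> harmonic unit_disk (gseries c p).
Proof.
  intros H.
  assert (Hext : forall u v : C -> R, (forall z, u z = v z) ->
            harmonicR unit_disk u -> harmonicR unit_disk v).
  { intros u v Huv Hu x y Hz. destruct (Hu x y Hz) as [H1 H2]. split.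
    - eapply ex_diff_n_ext_loc; [|exact H1].
      exists (mkposreal 1 Rlt_0_1). intros; apply Huv.
    - rewrite <- H2. unfold laplacian, partial_derive. f_equal.
      + apply Derive_n_ext. intro; simpl. now rewrite Huv.
      + simpl. apply Derive_ext. intro. apply Derive_ext. intro. now rewrite Huv. }
  split.
  - apply (Hext (fun z => Re (1 * gseries c p z)%C)).
    + intro z. now rewrite Cmult_1_l.
    + now apply harmonicR_Re_gseries.
  (* Multiplication by [- Ci] moves the imaginary part into the real part. *)
  - apply (Hext (fun z => Re (- Ci * gseries c p z)%C)).
    + intro z. destruct (gseries c p z). simpl. ring.
    + now apply harmonicR_Re_gseries.
Qed.

(** * The dyadic power sum against the logarithm *)

Lemma half_le_ln_1p (x : R) : 0 <= x <= 1 -> x / 2 <= ln (1 + x).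
Proof.
  intros Hx.
  (* The inequality exp t >= 1 + t at t = - ln (1 + x) gives ln (1 + x) >= x / (1 + x), which is at
     least x / 2 because x <= 1. *)
  pose proof (exp_ineq1_le (- ln (1 + x))) as H.
  rewrite exp_Ropp, exp_ln in H by lra.
  assert (x / 2 <= 1 - / (1 + x)); [|lra].
  apply Rmult_le_reg_r with (1 + x); [lra|].
  replace ((1 - / (1 + x)) * (1 + x)) with x by (field; lra). nra.
Qed.

Lemma ln_2_le_1 : ln 2 <= 1.
Proof.
  rewrite <- (ln_exp 1). apply ln_le; [lra|]. pose proof (exp_ineq1_le 1). lra.
Qed.

(* Telescoping [- ln (1 - s) = ln (1 + s) - ln (1 - s^2)] along [s = r^(2^i)]. *)
Lemma sum_dyadic_pow_le (r : R) (n : nat) :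
  0 <= r < 1 ->
  sum_n (fun i => r ^ (2 ^ i)) n <= 2 * - ln (1 - r) - 2 * - ln (1 - r ^ (2 ^ S n)).
Proof.
  intros Hr.
  assert (Hstep : forall s, 0 <= s < 1 -> s <= 2 * - ln (1 - s) - 2 * - ln (1 - s ^ 2)).
  { intros s Hs. replace (1 - s ^ 2) with ((1 + s) * (1 - s)) by ring.
    rewrite ln_mult by lra. pose proof (half_le_ln_1p s). lra. }
  assert (Hsq : forall i, r ^ (2 ^ S i) = (r ^ (2 ^ i)) ^ 2).
  { intro i. rewrite <- pow_mult. f_equal. simpl. lia. }
  assert (Hpow : forall i, 0 <= r ^ (2 ^ i) < 1).
  { induction i as [|i IH]; [simpl; lra|]. rewrite Hsq. simpl. nra. }
  induction n as [|n IH].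
  - rewrite sum_O, Hsq. pose proof (Hstep r Hr). simpl Nat.pow. rewrite pow_1. lra.
  - rewrite sum_Sn. change (plus ?a ?b) with (a + b).
    pose proof (Hstep _ (Hpow (S n))) as H. rewrite (Hsq (S n)). lra.
Qed.

(** The term subtracted in [sum_dyadic_pow_le] is nonnegative. Dropping it bounds the increasing
    partial sums uniformly in [n]. *)
Lemma series_dyadic_pow (r : R) :
  0 <= r < 1 ->
  ex_series (fun i => r ^ (2 ^ i)) /\ Series (fun i => r ^ (2 ^ i)) <= 2 * - ln (1 - r).
Proof.
  intros Hr.
  assert (Hb : forall n, sum_n (fun i => r ^ (2 ^ i)) n <= 2 * - ln (1 - r)).
  { intro n. pose proof (sum_dyadic_pow_le r n Hr).
    assert (0 <= r ^ (2 ^ S n)) by (apply pow_le; lra).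
    assert (r ^ (2 ^ S n) < 1).
    { apply pow_lt_1_compat; [lra|]. assert (2 ^ S n <> 0)%nat by (apply Nat.pow_nonzero; lia). lia. }
    assert (ln (1 - r ^ (2 ^ S n)) <= 0) by (rewrite <- ln_1; apply ln_le; lra).
    lra. }
  destruct (ex_finite_lim_seq_incr (sum_n (fun i => r ^ (2 ^ i))) (2 * - ln (1 - r)))
    as [l Hl].
  - intro n. rewrite sum_Sn. change (plus ?a ?b) with (a + b).
    assert (0 <= r ^ (2 ^ S n)) by (apply pow_le; lra). lra.
  - exact Hb.
  - split; [exists l; exact Hl|].
    rewrite (is_series_unique _ l Hl).
    exact (is_lim_seq_le _ _ (Finite l) (Finite (2 * - ln (1 - r))) Hb Hl (is_lim_seq_const _)).
Qed.

(** * Approximating a series by one constant block of its terms *)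

Definition below (m i : nat) : R := if Nat.ltb i m then 1 else 0.

Lemma is_series_below (m : nat) : is_series (below m) (INR m).
Proof.
  assert (Hsum : forall N, sum_n (below m) N = INR (Nat.min (S N) m)).
  { unfold below. induction N as [|N IH].
    - rewrite sum_O. destruct (Nat.ltb_spec 0 m).
      + now replace (Nat.min 1 m) with 1%nat by lia.
      + now replace (Nat.min 1 m) with 0%nat by lia.
    - rewrite sum_Sn, IH. change (plus ?a ?b) with (a + b).
      destruct (Nat.ltb_spec (S N) m).
      + replace (Nat.min (S (S N)) m) with (S (Nat.min (S N) m)) by lia.
        now rewrite S_INR.
      + replace (Nat.min (S (S N)) m) with (Nat.min (S N) m) by lia. apply Rplus_0_r. }
  change (is_lim_seq (sum_n (below m)) (INR m)).
  apply is_lim_seq_ext_loc with (fun _ => INR m); [|apply is_lim_seq_const].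
  exists m. intros N HN. rewrite Hsum. now replace (Nat.min (S N) m) with m by lia.
Qed.

(** The series is compared with [w] times the indicator of the block from [m] to [n]. The termwise
    difference is at most 1 before the block, zero on it, and at most [b i] after it. *)
Lemma Cseries_block_approx (u : nat -> C) (w : C) (b : nat -> R) (m n : nat) :
  (m <= n)%nat ->
  ex_series b -> (forall i, 0 <= b i) ->
  (forall i, (i < m)%nat -> Cmod (u i) <= 1) ->
  (forall i, (m <= i < n)%nat -> u i = w) ->
  (forall i, (n <= i)%nat -> Cmod (u i) <= b i) ->
  Cmod (Cseries u - RtoC (INR n - INR m) * w)%C <= 2 * (INR m + Series b).
Proof.
  intros Hmn Hb Hb0 Hlow Hmid Hhigh.
  assert (Hsm : ex_series (below m)) by (eexists; apply is_series_below).
  assert (Hsn : ex_series (below n)) by (eexists; apply is_series_below).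
  set (v := fun i => (RtoC (below n i - below m i))).
  assert (Hbelow : forall k i, Rabs (below k i) = below k i).
  { intros k i. unfold below. destruct (Nat.ltb i k); apply Rabs_pos_eq; lra. }
  assert (Hv : Csummable v).
  { apply Csummable_le with (fun i => below n i + below m i).
    - intro i. unfold v. rewrite Cmod_R.
      eapply Rle_trans; [apply Rabs_triang|].
      rewrite Rabs_Ropp, !Hbelow. lra.
    - now apply (ex_series_plus (V := R_NormedModule)). }
  assert (Hvw : Cseries (fun i => w * v i)%C = (RtoC (INR n - INR m) * w)%C).
  { rewrite Cseries_scal, Cmult_comm by exact Hv. f_equal.
    unfold Cseries, v, RtoC. simpl. f_equal.
    - rewrite Series_minus by assumption.
      now rewrite !(is_series_unique _ _ (is_series_below _)).
    - apply is_series_unique.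
      change (is_lim_seq (sum_n (fun _ => 0)) 0).
      apply is_lim_seq_ext with (fun _ => 0); [|apply is_lim_seq_const].
      intro N. rewrite sum_n_const. ring. }
  assert (Hs : ex_series (fun i => below m i + b i))
    by now apply (ex_series_plus (V := R_NormedModule)).
  assert (Huv : forall i, Cmod (u i - w * v i)%C <= below m i + b i).
  { intro i. unfold v, below. specialize (Hb0 i).
    destruct (Nat.ltb_spec i m).
    - destruct (Nat.ltb_spec i n); [|lia].
      replace (u i - w * RtoC (1 - 1))%C with (u i) by (rewrite Rminus_diag; ring).
      specialize (Hlow i ltac:(lia)). lra.
    - destruct (Nat.ltb_spec i n).
      + replace (u i - w * RtoC (1 - 0))%C with (RtoC 0)
          by (rewrite Rminus_0_r, Hmid by lia; ring).
        rewrite Cmod_0. lra.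
      + replace (u i - w * RtoC (0 - 0))%C with (u i) by (rewrite Rminus_0_r; ring).
        specialize (Hhigh i ltac:(lia)). lra. }
  assert (Hu : Csummable u).
  { apply Csummable_le with (fun i => (below m i + b i) + Cmod w * Cmod (v i)).
    - intro i. replace (u i) with ((u i - w * v i) + w * v i)%C by ring.
      eapply Rle_trans; [apply Cmod_triangle|].
      rewrite <- Cmod_mult. apply Rplus_le_compat_r, Huv.
    - apply (ex_series_plus (V := R_NormedModule)); [exact Hs|].
      now apply (ex_series_scal (V := R_NormedModule)). }
  rewrite <- Hvw, <- Cseries_minus; [|exact Hu | now apply Csummable_scal].
  eapply Rle_trans; [apply Cmod_Cseries_le; [exact Huv | exact Hs]|].
  rewrite Series_plus, (is_series_unique _ _ (is_series_below m)) by assumption. lra.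
Qed.

(** * Block structure of the exponents *)

(** [Nat.log2 i / 6] is the integer part of the logarithm of [i] in base 64, with value 0 at
    [i = 0]. *)
Definition level (i : nat) : nat := (2 * 64 ^ S (Nat.log2 i / 6))%nat.

Lemma pow_64 (k : nat) : (64 ^ k = 2 ^ (6 * k))%nat.
Proof. now rewrite Nat.pow_mul_r. Qed.

Lemma lt_64_pow_log (i : nat) : (i < 64 ^ S (Nat.log2 i / 6))%nat.
Proof.
  rewrite pow_64. destruct (Nat.eq_dec i 0) as [->|Hi]; [now simpl; lia|].
  destruct (Nat.log2_spec i ltac:(lia)) as [_ H].
  eapply Nat.lt_le_trans; [exact H|]. apply Nat.pow_le_mono_r; [lia|].
  pose proof (Nat.div_mod_eq (Nat.log2 i) 6).
  pose proof (Nat.mod_upper_bound (Nat.log2 i) 6). lia.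
Qed.

Lemma le_log_of_64_pow_le (k i : nat) : (64 ^ k <= i)%nat -> (k <= Nat.log2 i / 6)%nat.
Proof.
  rewrite pow_64. intro H. apply Nat.log2_le_mono in H.
  rewrite Nat.log2_pow2 in H by lia.
  apply Nat.div_le_lower_bound; lia.
Qed.

(** The factor 2 in [level] provides two copies of one power of 64: the first exceeds [i], the
    second is at least [64 ^ S k]. This slack makes the terms beyond a block decay like a dyadic
    power sum. *)
Lemma level_ge (k i : nat) : (64 ^ k <= i)%nat -> (i + 64 ^ S k <= level i)%nat.
Proof.
  intro H. pose proof (lt_64_pow_log i). apply le_log_of_64_pow_le in H.
  assert (64 ^ S k <= 64 ^ S (Nat.log2 i / 6))%nat by (apply Nat.pow_le_mono_r; lia).
  unfold level. lia.
Qed.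

Lemma le_level (i : nat) : (i <= level i)%nat.
Proof. pose proof (lt_64_pow_log i). unfold level. lia. Qed.

Lemma level_block (k i : nat) :
  (64 ^ k <= i < 64 ^ S k)%nat -> level i = (2 * 64 ^ S k)%nat.
Proof.
  intros [H1 H2]. unfold level. do 3 f_equal.
  apply le_log_of_64_pow_le in H1.
  destruct (Nat.eq_dec i 0) as [->|Hi].
  { simpl. simpl in H1. lia. }
  destruct (Nat.log2_spec i ltac:(lia)) as [H _].
  assert (Nat.log2 i < 6 * S k)%nat.
  { apply (Nat.pow_lt_mono_r_iff 2); [lia|]. rewrite <- pow_64. lia. }
  pose proof (Nat.Div0.div_lt_upper_bound (Nat.log2 i) 6 (S k)). lia.
Qed.

(** * The witness: growth and approximation on circles *)

Definition h_coef (i : nat) : R := 1.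

Definition h_exp (i : nat) : nat := (2 ^ level i)%nat.

Lemma pow_le_pow_exp (r : R) (m n : nat) : 0 <= r <= 1 -> (m <= n)%nat -> r ^ n <= r ^ m.
Proof.
  intros Hr Hmn. replace n with (m + (n - m))%nat by lia. rewrite pow_add.
  rewrite <- (Rmult_1_r (r ^ m)) at 2.
  apply Rmult_le_compat_l; [now apply pow_le|].
  rewrite <- (pow1 (n - m)). apply pow_incr. lra.
Qed.

Lemma pow_level_le (r : R) (i n : nat) :
  0 <= r <= 1 -> (n <= level i)%nat -> r ^ h_exp i <= r ^ (2 ^ n).
Proof.
  intros Hr Hn. apply pow_le_pow_exp; [exact Hr|]. apply Nat.pow_le_mono_r; lia.
Qed.

Lemma h_term (z : C) (i : nat) : (RtoC (h_coef i) * z ^ h_exp i = z ^ h_exp i)%C.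
Proof. unfold h_coef. ring. Qed.

Lemma h_summable : disk_summable h_coef h_exp.
Proof.
  intros r Hr. destruct (series_dyadic_pow r Hr) as [H _].
  apply (@ex_series_le R_AbsRing R_CompleteNormedModule _ (fun i => r ^ (2 ^ i)));
    [|exact H].
  intro i. change (Rabs (Rabs 1 * r ^ h_exp i) <= r ^ (2 ^ i)).
  rewrite Rabs_R1, Rmult_1_l, Rabs_pos_eq by (apply pow_le; lra).
  apply pow_level_le; [lra | apply le_level].
Qed.

(** Termwise comparison through [le_level]; the 4 is the 2 of [Cmod_Cseries_le] times the 2 of
    [series_dyadic_pow]. *)
Lemma h_bound (z : C) :
  Cmod z < 1 -> Cmod (gseries h_coef h_exp z) <= 4 * - ln (1 - Cmod z).
Proof.
  intro Hz. pose proof (Cmod_ge_0 z).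
  destruct (series_dyadic_pow (Cmod z)) as [H1 H2]; [lra|].
  eapply Rle_trans.
  { apply Cmod_Cseries_le with (b := fun i => Cmod z ^ (2 ^ i)); [|exact H1].
    intro i. rewrite h_term, Cmod_pow. apply pow_level_le; [lra | apply le_level]. }
  lra.
Qed.

(** [M] records the scale of the radius through [s = Cmod z ^ (2 ^ M)]. From index [n] on, the terms
    are at most [s ^ (2 ^ i)], with sum at most - 2 ln (1 - s) <= 2 ln 2 <= 2; this is the 2 added
    to [INR m]. *)
Lemma h_approx (z w : C) (M m n : nat) :
  Cmod z < 1 -> Cmod z ^ (2 ^ M) <= / 2 -> (m <= n)%nat ->
  (forall i, (m <= i < n)%nat -> (z ^ h_exp i)%C = w) ->
  (forall i, (n <= i)%nat -> (i + M <= level i)%nat) ->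
  Cmod (gseries h_coef h_exp z - RtoC (INR n - INR m) * w)%C <= 2 * (INR m + 2).
Proof.
  intros Hz HM Hmn Hmid Hhigh. pose proof (Cmod_ge_0 z) as Hz0.
  set (s := Cmod z ^ (2 ^ M)) in *.
  assert (Hs : 0 <= s) by now apply pow_le.
  destruct (series_dyadic_pow s) as [H1 H2]; [lra|].
  eapply Rle_trans.
  { apply (Cseries_block_approx _ w (fun i => s ^ (2 ^ i))); [exact Hmn | exact H1 | | | |].
    - intro i. now apply pow_le.
    - intros i Hi. rewrite h_term, Cmod_pow.
      rewrite <- (pow1 (h_exp i)). apply pow_incr. lra.
    - intros i Hi. rewrite h_term. now apply Hmid.
    - intros i Hi. rewrite h_term, Cmod_pow. unfold s.
      rewrite <- pow_mult, <- Nat.pow_add_r.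
      apply pow_level_le; [lra|]. specialize (Hhigh i Hi). lia. }
  assert (- ln (1 - s) <= 1).
  { rewrite <- ln_Rinv by lra. eapply Rle_trans; [|exact ln_2_le_1].
    apply ln_le; [apply Rinv_0_lt_compat; lra|].
    rewrite <- (Rinv_inv 2). apply Rinv_le_contravar; lra. }
  lra.
Qed.

(** * Powers and logarithms at the radii 1 - 2^(-M) *)

Lemma INR_pow2 (M : nat) : INR (2 ^ M) * (/ 2) ^ M = 1.
Proof.
  rewrite pow_INR. change (INR 2) with 2. rewrite <- Rpow_mult_distr.
  rewrite Rinv_r by lra. apply pow1.
Qed.

Lemma half_pow_bounds (M : nat) : 0 < (/ 2) ^ M <= 1.
Proof.
  split; [apply pow_lt; lra|]. rewrite <- (pow1 M). apply pow_incr. lra.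
Qed.

(** Induction gives (1 - t)^n (1 + n t) <= 1; the claim is the case n t = 1. *)
Lemma dyadic_radius_pow_le (M : nat) : (1 - (/ 2) ^ M) ^ (2 ^ M) <= / 2.
Proof.
  pose proof (half_pow_bounds M) as Ht. pose proof (INR_pow2 M) as HN.
  set (t := (/ 2) ^ M) in *. set (N := (2 ^ M)%nat) in *. clearbody t N.
  assert (H : forall n, (1 - t) ^ n * (1 + INR n * t) <= 1).
  { induction n as [|n IH]; [simpl; lra|]. rewrite S_INR. simpl.
    assert (0 <= (1 - t) ^ n) by (apply pow_le; lra).
    pose proof (pos_INR n).
    assert (0 <= (1 - t) ^ n * ((INR n + 1) * (t * t))).
    { apply Rmult_le_pos; [assumption|]. apply Rmult_le_pos; nra. }
    nra. }
  specialize (H N). rewrite HN in H. lra.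
Qed.

(** Bernoulli's inequality at the full exponent would only give 0. At half the exponent, where n t =
    1/2, it gives 1/2, and squaring gives 1/4. *)
Lemma dyadic_radius_pow_ge (M : nat) : / 4 <= (1 - (/ 2) ^ S M) ^ (2 ^ S M).
Proof.
  pose proof (half_pow_bounds (S M)) as Ht. pose proof (INR_pow2 M) as HN.
  replace (2 ^ S M)%nat with (2 ^ M * 2)%nat by (simpl; lia).
  rewrite pow_mult.
  assert (Hb : INR (2 ^ M) * (/ 2) ^ S M = / 2) by (simpl; nra).
  set (t := (/ 2) ^ S M) in *. set (N := (2 ^ M)%nat) in *. clearbody t N.
  assert (H : forall n, 1 - INR n * t <= (1 - t) ^ n).
  { induction n as [|n IH]; [simpl; lra|]. rewrite S_INR. simpl.
    pose proof (pos_INR n).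
    assert ((1 - t) * (1 - INR n * t) <= (1 - t) * (1 - t) ^ n)
      by (apply Rmult_le_compat_l; lra).
    assert (0 <= INR n * t * t) by (apply Rmult_le_pos; [apply Rmult_le_pos|]; lra).
    nra. }
  specialize (H N). rewrite Hb in H. simpl. nra.
Qed.

Lemma Rabs_ln_dyadic_radius (M : nat) :
  Rabs (ln (1 - (1 - (/ 2) ^ M))) = INR M * ln 2.
Proof.
  replace (1 - (1 - (/ 2) ^ M)) with ((/ 2) ^ M) by ring.
  rewrite ln_pow, ln_Rinv by lra.
  replace (INR M * - ln 2) with (- (INR M * ln 2)) by ring.
  rewrite Rabs_Ropp, Rabs_pos_eq; [reflexivity|].
  apply Rmult_le_pos; [apply pos_INR|]. pose proof ln_lt_2. lra.
Qed.

(** * Oscillation of the quotient along every radius *)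

Definition radial_quotient (xi : C) (r : R) : C :=
  (gseries h_coef h_exp (RtoC r * xi) / RtoC (Rabs (ln (1 - r))))%C.

Lemma Cmod_radial_quotient (xi : C) (M : nat) :
  (0 < M)%nat ->
  Cmod (radial_quotient xi (1 - (/ 2) ^ M)) =
  Cmod (gseries h_coef h_exp (RtoC (1 - (/ 2) ^ M) * xi)) / (INR M * ln 2).
Proof.
  intro HM. unfold radial_quotient. rewrite Rabs_ln_dyadic_radius.
  assert (HL : 0 < INR M * ln 2).
  { apply Rmult_lt_0_compat; [now apply lt_0_INR|]. pose proof ln_lt_2. lra. }
  rewrite Cmod_div, Cmod_R, Rabs_pos_eq; [reflexivity | lra |].
  intro H. apply RtoC_inj in H. lra.
Qed.

(** With y = 64^k >= 64, the numerator is at most 2 (y + 2) and the denominator is 64 y ln 2. *)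
Lemma radial_quotient_small (xi : C) (k : nat) :
  Cmod xi = 1 -> (1 <= k)%nat ->
  Cmod (radial_quotient xi (1 - (/ 2) ^ (64 ^ S k))) <= / 25 / ln 2.
Proof.
  intros Hxi Hk. set (x := (64 ^ S k)%nat).
  assert (Hx : (x = 64 * 64 ^ k)%nat) by reflexivity.
  assert (Hy : (64 <= 64 ^ k)%nat).
  { change 64%nat with (64 ^ 1)%nat at 1. apply Nat.pow_le_mono_r; lia. }
  rewrite Cmod_radial_quotient by lia.
  pose proof (half_pow_bounds x).
  assert (Hz : Cmod (RtoC (1 - (/ 2) ^ x) * xi)%C = 1 - (/ 2) ^ x)
    by (rewrite Cmod_mult, Cmod_R, Hxi, Rabs_pos_eq; lra).
  (* The block is empty, [m = n = 64 ^ k], so [w] can be 0. *)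
  assert (Happ := h_approx (RtoC (1 - (/ 2) ^ x) * xi)%C 0 x (64 ^ k) (64 ^ k)).
  rewrite Hz in Happ.
  specialize (Happ ltac:(lra) (dyadic_radius_pow_le x) (le_n _) ltac:(intros; lia)
                   (fun i => level_ge k i)).
  set (H0 := gseries _ _ _) in *.
  replace (H0 - RtoC (INR (64 ^ k) - INR (64 ^ k)) * 0)%C with H0 in Happ by ring.
  rewrite Hx, mult_INR.
  apply le_INR in Hy.
  assert (H64 : INR 64 = 64) by (simpl; ring). rewrite H64 in *.
  set (y := INR (64 ^ k)) in *. clearbody y.
  pose proof ln_lt_2.
  apply Rmult_le_reg_r with (64 * y * ln 2).
  { apply Rmult_lt_0_compat; lra. }
  replace (Cmod H0 / (64 * y * ln 2) * (64 * y * ln 2)) with (Cmod H0) by (field; lra).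
  replace (/ 25 / ln 2 * (64 * y * ln 2)) with (64 / 25 * y) by (field; lra).
  lra.
Qed.

(** With y = 64^k >= 64, the block supplies 63 y equal terms of modulus at least 1/4. The error 2 (y
    + 2) leaves more than 12.8 y, against the denominator 128 y ln 2. *)
Lemma radial_quotient_large (xi : C) (k : nat) :
  Cmod xi = 1 -> (1 <= k)%nat ->
  / 10 / ln 2 <= Cmod (radial_quotient xi (1 - (/ 2) ^ (2 * 64 ^ S k))).
Proof.
  intros Hxi Hk. set (M := (2 * 64 ^ S k)%nat).
  assert (HM : (M = 128 * 64 ^ k)%nat) by (unfold M; simpl; lia).
  assert (Hy : (64 <= 64 ^ k)%nat).
  { change 64%nat with (64 ^ 1)%nat at 1. apply Nat.pow_le_mono_r; lia. }
  rewrite Cmod_radial_quotient by lia.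
  pose proof (half_pow_bounds M).
  set (z := (RtoC (1 - (/ 2) ^ M) * xi)%C).
  assert (Hz : Cmod z = 1 - (/ 2) ^ M)
    by (unfold z; rewrite Cmod_mult, Cmod_R, Hxi, Rabs_pos_eq; lra).
  assert (Hw : / 4 <= Cmod (z ^ (2 ^ M))%C).
  { rewrite Cmod_pow, Hz. destruct M as [|M']; [lia|]. apply dyadic_radius_pow_ge. }
  assert (Happ : Cmod (gseries h_coef h_exp z -
    RtoC (INR (64 ^ S k) - INR (64 ^ k)) * z ^ (2 ^ M))%C <= 2 * (INR (64 ^ k) + 2)).
  { apply h_approx with M.
    - rewrite Hz. lra.
    - rewrite Hz. apply dyadic_radius_pow_le.
    - apply Nat.pow_le_mono_r; lia.
    - intros i Hi. unfold h_exp. now rewrite (level_block k i Hi).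
    - intros i Hi. apply level_ge in Hi.
      assert (64 ^ S (S k) = 64 * 64 ^ S k)%nat by reflexivity. unfold M. lia. }
  set (w := (z ^ (2 ^ M))%C) in *. set (H0 := gseries _ _ _) in *. clearbody w H0.
  rewrite HM, mult_INR.
  replace (64 ^ S k)%nat with (64 * 64 ^ k)%nat in Happ by reflexivity.
  rewrite mult_INR in Happ.
  apply le_INR in Hy.
  assert (H64 : INR 64 = 64) by (simpl; ring). rewrite H64 in *.
  assert (H128 : INR 128 = 128) by (simpl; ring). rewrite H128.
  set (y := INR (64 ^ k)) in *. clearbody y.
  replace (64 * y - y) with (63 * y) in Happ by ring.
  assert (Hmain : 63 * y * / 4 <= Cmod (RtoC (63 * y) * w)%C).
  { rewrite Cmod_mult, Cmod_R, Rabs_pos_eq by lra. apply Rmult_le_compat_l; lra. }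
  assert (Htri : Cmod (RtoC (63 * y) * w)%C
                 <= Cmod H0 + Cmod (H0 - RtoC (63 * y) * w)%C).
  { replace (RtoC (63 * y) * w)%C with (H0 + - (H0 - RtoC (63 * y) * w))%C at 1 by ring.
    eapply Rle_trans; [apply Cmod_triangle|]. rewrite Cmod_opp. lra. }
  pose proof ln_lt_2.
  apply Rmult_le_reg_r with (128 * y * ln 2).
  { apply Rmult_lt_0_compat; lra. }
  replace (Cmod H0 / (128 * y * ln 2) * (128 * y * ln 2)) with (Cmod H0) by (field; lra).
  replace (/ 10 / ln 2 * (128 * y * ln 2)) with (128 / 10 * y) by (field; lra).
  lra.
Qed.

(** Arbitrarily close to the circle the modulus drops to 1 / (25 ln 2) and rises to 1 / (10 ln 2).
    As ln 2 <= 1, the gap is at least 6/100. *)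
Lemma radial_quotient_no_limit (xi l : C) :
  Cmod xi = 1 -> ~ filterlim (radial_quotient xi) (at_left 1) (locally l).
Proof.
  intros Hxi Hlim.
  (* Balls are taken coordinatewise, so each value lies within 2/100 of [l] and two values differ by
     less than 4/100, below the gap. *)
  assert (Heps : 0 < / 100) by lra.
  destruct (proj1 (filterlim_locally _ _) Hlim (mkposreal _ Heps)) as [delta Hd].
  assert (Hclose : forall M, (/ 2) ^ M < delta ->
            Cmod (radial_quotient xi (1 - (/ 2) ^ M) - l)%C < 2 * / 100).
  { intros M HM. pose proof (half_pow_bounds M).
    destruct (Hd (1 - (/ 2) ^ M)) as [H1 H2].
    - change (Rabs ((1 - (/ 2) ^ M) - 1) < delta).
      replace ((1 - (/ 2) ^ M) - 1) with (- (/ 2) ^ M) by ring.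
      rewrite Rabs_Ropp, Rabs_pos_eq; lra.
    - lra.
    - set (q := radial_quotient _ _) in *. clearbody q. destruct q as [q1 q2], l as [l1 l2].
      apply Cmod_pair_near; [exact H1 | exact H2]. }
  destruct (pow_lt_1_zero (/ 2) ltac:(rewrite Rabs_pos_eq; lra) delta (cond_pos delta))
    as [N HN].
  (* The successor ensures [1 <= k]; since [k < 64 ^ S k], both radii are within [delta] of 1. *)
  set (k := S N).
  assert (Hk : (k < 64 ^ S k)%nat).
  { assert (H := Nat.pow_gt_lin_r 64 k ltac:(lia)).
    assert (64 ^ k <= 64 ^ S k)%nat by (apply Nat.pow_le_mono_r; lia). lia. }
  assert (Hsmall : forall M, (k <= M)%nat -> (/ 2) ^ M < delta).
  { intros M HM. specialize (HN M ltac:(lia)). pose proof (half_pow_bounds M).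
    rewrite Rabs_pos_eq in HN; lra. }
  pose proof (Hclose _ (Hsmall (64 ^ S k)%nat ltac:(lia))) as C1.
  pose proof (Hclose _ (Hsmall (2 * 64 ^ S k)%nat ltac:(lia))) as C2.
  pose proof (radial_quotient_small xi k Hxi ltac:(lia)) as Q1.
  pose proof (radial_quotient_large xi k Hxi ltac:(lia)) as Q2.
  set (q1 := radial_quotient _ _) in *.
  set (q2 := radial_quotient _ (1 - (/ 2) ^ (2 * 64 ^ S k))) in *.
  clearbody q1 q2.
  assert (Htri : Cmod q2 <= Cmod q1 + Cmod (q2 - l)%C + Cmod (q1 - l)%C).
  { replace q2 with (q1 + (q2 - l) + - (q1 - l))%C at 1 by ring.
    eapply Rle_trans; [apply Cmod_triangle|]. rewrite Cmod_opp.
    pose proof (Cmod_triangle q1 (q2 - l)%C). lra. }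
  assert (Hln : 1 <= / ln 2).
  { rewrite <- Rinv_1 at 1. apply Rinv_le_contravar; [|apply ln_2_le_1].
    pose proof ln_lt_2. lra. }
  unfold Rdiv in *. lra.
Qed.

Theorem proposition7p4 :
  exists h : C -> C,
    harmonic unit_disk h /\
    (exists M : R, forall z : C, unit_disk z -> z <> RtoC 0 ->
       Cmod (log_quotient h z) <= M) /\
    (forall xi : C, unit_circle xi ->
       ~ exists l : C,
           filterlim (fun r : R => (h (RtoC r * xi) / RtoC (Rabs (ln (1 - r))))%C)
                     (at_left 1) (locally l)).
Proof.
  exists (gseries h_coef h_exp). split; [|split].
  - apply harmonic_gseries, h_summable.
  - exists 4. intros z Hz Hz0. unfold unit_disk in Hz.
    apply Cmod_gt_0 in Hz0.
    assert (HL : 0 < - ln (1 - Cmod z)).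
    { assert (ln (1 - Cmod z) < 0); [|lra].
      rewrite <- ln_1. apply ln_increasing; lra. }
    unfold log_quotient.
    rewrite <- Rabs_Ropp, (Rabs_pos_eq _ (Rlt_le _ _ HL)).
    rewrite Cmod_div, Cmod_R, (Rabs_pos_eq _ (Rlt_le _ _ HL))
      by (intro H; apply RtoC_inj in H; lra).
    apply Rmult_le_reg_r with (- ln (1 - Cmod z)); [exact HL|].
    unfold Rdiv. rewrite Rmult_assoc, Rinv_l, Rmult_1_r by lra.
    now apply h_bound.
  - intros xi Hxi [l Hl]. exact (radial_quotient_no_limit xi l Hxi Hl).
Qed.
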